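(* Let $G$ be a linear graph satisfying the bounded jumps condition: there exists a positive integer $K$ such that $j-i<K$ for every edge $(i,j)\in E(G)$ with $i<j$. Let $\mathcal W:E(G)\to(0,\infty)$ be a weight function such that $(G,\mathcal W)$ is an unstable positive loaded graph. Then the sequence of finite subgraphs $G_n$, $n\ge1$, is regular relative to $\mathcal W$.
   Context: Graphs and paths. A directed graph $G=(V,E)$ has a finite or countable vertex set $V=V(G)$ and edge set $E=E(G)\subset V\times V$; $(u,w)\in E$ is an edge from $u$ to $w$. A path of length $\ell\ge1$ from $u$ to $w$ is a sequence of $\ell$ consecutive edges starting at $u$ and ending at $w$. $G'$ is a subgraph of $G$ ($G'\subset G$) if $V(G')\subset V(G)$ and $E(G')\subset E(G)$. $G$ is connected if for each ordered pair $u,w$ of vertices there is a path from $u$ to $w$. A simple $u$-cycle is a path from $u$ to $u$ that visits $u$ only at its beginning and its end; $\ell(\gamma)$ denotes the length of $\gamma$. Linear graph. A linear graph is a directed graph $G$ with $V(G)=\mathbb N=\{1,2,\dots\}$ and $E(G)=E_1\cup E_2$, where $E_1$ consists of all pairs $(i,1)$ and $(i,i+1)$, $i\in\mathbb N$, and $E_2$ is some set of pairs $(i,j)$ with $i<j-1$ such that for each $i$ there are only finitely many $j$ with $(i,j)\in E_2$. Put $v:=1$. Subgraphs. For a family $\Gamma$ of paths in $G$, $G(\Gamma)$ is the minimal subgraph of $G$ containing all paths from $\Gamma$. $\Gamma_\ell$ is the family of all simple $v$-cycles of length $\ell$ in $G$. For $n\ge1$, $G_n:=G\big(\bigcup_{\ell\le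 n}\Gamma_\ell\big)$; this is a finite connected graph. Loaded graphs. A loaded graph is a pair $(G,\mathcal W)$ with $\mathcal W:E(G)\to(0,\infty)$; the weight $\mathcal W(\gamma)$ of a path is the product of the weights of its edges. For a vertex $u$ let $q_u(n)$ be the sum of the weights of all simple $u$-cycles of length $n$, $\Phi_{u,u|u}(G,\mathcal W,z)=\sum_{n\ge1}q_u(n)z^n$ ($z\ge 0$), and let $R_u$ be the radius of convergence of this series; it is assumed that $R_u>0$. $(G,\mathcal W)$ ($G$ connected) is unstable positive if for some vertex $u$ one has $\Phi_{u,u|u}(G,\mathcal W,R_u)=1$ and $\frac{d}{dz}\Phi_{u,u|u}(G,\mathcal W,z)|_{z=R_u}=\sum_{n\ge1} nq_u(n)R_u^{n-1}<\infty$ (equivalently, this holds for all vertices $u$). Equilibrium measures. Let $H$ be either a finite connected subgraph of $G$ (loaded with the restriction of $\mathcal W$) or $G$ itself with $(G,\mathcal W)$ unstable positive. Let $A$ be the $V(H)\times V(H)$ matrix with entries $A(u,w)=\mathcal W(u,w)$ if $(u,w)\in E(H)$ and $0$ otherwise. Let $\lambda=1/\rho$, where $\rho>0$ is the solution of $\Phi_{v,v|v}(H,\mathcal W,\rho)=1$ (for finite $H$, $\lambda$ is the Perron eigenvalue of $A$; for $H=G$, $\rho=R_v$). There are positive vectors $l,r$, unique up to scaling, with $lA=\lambda l$, $Ar=\lambda r$ and $\sum_u l_ur_u<\infty$; normalize so that $\sum_u l_ur_u=1$. The equilibrium measure $\mu^{H,\mathcal W}$ is the shift-invariant Markov probability measure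 on two-sided infinite paths given by $\mu^{H,\mathcal W}(\omega_s=u_0,\dots,\omega_{s+t}=u_t)=\lambda^{-t}l_{u_0}\prod_{i=0}^{t-1}A(u_i,u_{i+1})\,r_{u_t}$. For $H\subset G$ it is regarded as a measure on $\Omega(G)=\{(\omega_i)_{i\in\mathbb Z}:(\omega_i,\omega_{i+1})\in E(G)\ \forall i\}$. Regular sequences. A sequence of subgraphs $H_k$ of $G$ is exhaustive if $H_k\subset H_{k+1}$ for all $k$, $\bigcup_kV(H_k)=V(G)$ and $\bigcup_kE(H_k)=E(G)$. An exhaustive sequence of finite connected subgraphs $H_k$ is regular relative to $\mathcal W$ if $\mu^{H_k,\mathcal W}$ converges weakly to $\mu^{G,\mathcal W}$ as $k\to\infty$ ($\Omega(G)$ carrying the topology induced by the product of discrete topologies); equivalently, $\mu^{H_k,\mathcal W}(C)\to\mu^{G,\mathcal W}(C)$ for every cylinder set $C=\{\omega\in\Omega(G):\omega_s=u_0,\dots,\omega_{s+t}=u_t\}$. *)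

(* Defs.v *)
From HB Require Import structures.
From mathcomp Require Import all_boot all_order all_algebra.
From mathcomp Require Import all_classical all_reals all_analysis.

Set Implicit Arguments.
Unset Strict Implicit.
Unset Printing Implicit Defensive.

Import Order.TTheory GRing.Theory Num.Theory.
Import numFieldNormedType.Exports.

Local Open Scope classical_set_scope.
Local Open Scope ring_scope.

(* A finite or countable directed graph, its vertices labelled by natural
   numbers. *)
Record digraph := Digraph {
  verts : set nat;
  edges : set (nat * nat);
  edges_verts : forall e, edges e -> verts e.1 /\ verts e.2 }.

Definition subgraph (H G : digraph) : Prop :=
  verts H `<=` verts G /\ edges H `<=` edges G.

(* A path is given by its starting vertex u and the sequence p of the vertices
   visited after u; its length is size p. *)
Definition steps (u : nat) (p : seq nat) : seq (nat * nat) := zip (u :: p) p.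

Definition is_path (G : digraph) (u w : nat) (p : seq nat) : Prop :=
  [/\ (0 < size p)%N, forall e, e \in steps u p -> edges G e & last u p = w].

Definition connected_graph (G : digraph) : Prop :=
  forall u w, verts G u -> verts G w -> exists p, is_path G u w p.

(* Besides the starting point, u occurs exactly once along p; since p ends at
   u, this occurrence is the last entry. *)
Definition simple_cycle (G : digraph) (u : nat) (p : seq nat) : Prop :=
  is_path G u u p /\ count_mem u p = 1%N.

Definition linear_graph (G : digraph) : Prop :=
  verts G = [set i | (0 < i)%N] /\
  exists E2 : set (nat * nat),
    [/\ forall i j, E2 (i, j) -> (0 < i)%N /\ (i.+1 < j)%N,
        forall i, finite_set [set j | E2 (i, j)] &
        edges G =
          [set e | (0 < e.1)%N /\ (e.2 = 1%N \/ e.2 = e.1.+1)] `|` E2].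

Definition bounded_jumps (G : digraph) : Prop :=
  exists2 K : nat, (0 < K)%N &
    forall i j, edges G (i, j) -> (i < j)%N -> (j - i < K)%N.

(* Gamma is a family of paths, each given as a pair (u, p). *)
Section Spanned.
Variable Gamma : set (nat * seq nat).

Let spanned_verts : set nat :=
  [set x | exists2 g, Gamma g & x \in g.1 :: g.2].

Let spanned_edges : set (nat * nat) :=
  [set e | exists2 g, Gamma g & e \in steps g.1 g.2].

Lemma spanned_edges_verts e :
  spanned_edges e -> spanned_verts e.1 /\ spanned_verts e.2.
Proof.
have mem_steps u p : e \in steps u p -> e.1 \in u :: p /\ e.2 \in u :: p.
  rewrite /steps; elim: p u => [|x p IHp] u //=; rewrite inE.
  case/orP => [/eqP -> /=|/IHp[e1 e2]]; first by rewrite !inE !eqxx orbT.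
  by rewrite ![_ \in u :: _]inE e1 e2 !orbT.
by case=> g Gg /mem_steps[e1 e2]; split; exists g.
Qed.

Definition spanned_graph : digraph := Digraph spanned_edges_verts.

End Spanned.

Definition Gsub (v : nat) (G : digraph) (n : nat) : digraph :=
  spanned_graph
    [set g | [/\ g.1 = v, simple_cycle G v g.2 & (size g.2 <= n)%N]].

Definition exhaustive (G : digraph) (H : nat -> digraph) : Prop :=
  [/\ forall k, subgraph (H k) (H k.+1),
      \bigcup_k verts (H k) = verts G & \bigcup_k edges (H k) = edges G].

Section Loaded.
Context {R : realType}.
Implicit Types (G H : digraph) (W : nat -> nat -> R).

Definition path_weight W (u : nat) (p : seq nat) : R :=
  \prod_(e <- steps u p) W e.1 e.2.

Definition cycle_weight G W (u n : nat) : \bar R :=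
  \esum_(p in [set p | simple_cycle G u p /\ size p = n])
     (path_weight W u p)%:E.

Definition Phi G W (u : nat) (z : R) : \bar R :=
  (\sum_(1 <= n <oo) cycle_weight G W u n * (z ^+ n)%:E)%E.

Definition dPhi G W (u : nat) (z : R) : \bar R :=
  (\sum_(1 <= n <oo) n%:R%:E * cycle_weight G W u n * (z ^+ n.-1)%:E)%E.

(* The coefficients being nonnegative, the radius of convergence is the
   supremum of the z >= 0 at which the series is finite. *)
Definition Phi_radius G W (u : nat) : \bar R :=
  ereal_sup [set z%:E | z in [set z : R | 0 <= z /\ (Phi G W u z < +oo)%E]].

(* The values of W outside the edge set are irrelevant. *)
Definition loaded_graph G W : Prop :=
  (forall e, edges G e -> 0 < W e.1 e.2) /\
  (forall u, verts G u -> (0 < Phi_radius G W u)%E).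

Definition unstable_positive G W : Prop :=
  connected_graph G /\
  exists u : nat, verts G u /\
  exists rho : R, [/\ Phi_radius G W u = rho%:E,
                      Phi G W u rho = 1%E & (dPhi G W u rho < +oo)%E].

Definition adjacency H W (u w : nat) : R :=
  if `[< edges H (u, w) >] then W u w else 0.

Definition Omega G : set (int -> nat) :=
  [set w | forall i : int, edges G (w i, w (i + 1))].

Definition cylinder (s : int) (x : seq nat) : set (int -> nat) :=
  [set w | forall i : nat, (i < size x)%N -> w (s + i%:Z) = nth 0%N x i].

Definition trajectories :=
  g_sigma_algebraType [set C | exists s x, C = cylinder s x].

Definition is_equilibrium (v : nat) H W (mu : probability trajectories R) :
    Prop :=
  mu (Omega H) = 1%E /\
  exists (rho : R) (l r : nat -> R),
  let A := adjacency H W in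
  let lambda := rho^-1 in
  [/\ 0 < rho /\ Phi H W v rho = 1%E,
      forall u, verts H u -> 0 < l u /\ 0 < r u,
      forall w, verts H w ->
        \esum_(u in verts H) (l u * A u w)%:E = (lambda * l w)%:E /\
        \esum_(u in verts H) (A w u * r u)%:E = (lambda * r w)%:E,
      \esum_(u in verts H) (l u * r u)%:E = 1%E &
      forall (s : int) (u : nat) (p : seq nat),
        (forall x, x \in u :: p -> verts H x) ->
        mu (cylinder s (u :: p)) =
          (lambda ^- size p * l u * path_weight A u p * r (last u p))%:E].

(* Weak convergence of probability measures carried by Omega G, for the
   topology that Omega G inherits from the product of discrete spaces. *)
Definition weak_cvg G (mu_ : nat -> probability trajectories R)
    (mu : probability trajectories R) : Prop :=
  forall f : {ptws int -> nat} -> R,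
    {within (Omega G : set {ptws int -> nat}), continuous f} ->
    (exists M : R, forall w, Omega G w -> `|f w| <= M) ->
    (\int[mu_ k]_(w in Omega G) (f w)%:E)%E @[k --> \oo] -->
      (\int[mu]_(w in Omega G) (f w)%:E)%E.

(* A finite connected graph containing v, and G if unstable positive, carries
   exactly one equilibrium measure: mu_ and mu range over single values.  An
   exhaustive sequence may miss v for finitely many k, where the equation
   Phi (H k) W v rho = 1 is meaningless; these k do not affect the limit. *)
Definition regular (v : nat) G W (H : nat -> digraph) : Prop :=
  [/\ exhaustive G H,
      forall k, finite_set (verts (H k)) /\ connected_graph (H k) &
      forall (mu_ : nat -> probability trajectories R)
             (mu : probability trajectories R),
        (forall k, verts (H k) v -> is_equilibrium v (H k) W (mu_ k)) ->
        is_equilibrium v G W mu ->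
        weak_cvg G mu_ mu].

End Loaded.

(* Main.v *)
Require Import Defs.
From mathcomp Require Import all_boot all_order all_algebra.
From mathcomp Require Import all_classical all_reals all_analysis.
From mathcomp Require Import measurable_realfun.
From mathcomp Require Import ring lra zify.

Set Implicit Arguments.
Unset Strict Implicit.
Unset Printing Implicit Defensive.

Import Order.TTheory GRing.Theory Num.Theory.
Import numFieldNormedType.Exports.

Local Open Scope classical_set_scope.
Local Open Scope ring_scope.

(** The matrix of the linear graph only moves forward, by less than K, or back
    to vertex 1.  Scale the eigenvectors l, r of G and l', r' of the n-th
    subgraph to be 1 at vertex 1, and let t = rho' / rho be the ratio of the
    inverse eigenvalues.  A cylinder has measure
    rho ^ length * l * weight * r / Z, where Z is the sum of l u * r u.

    Vertices of the n-th subgraph are at most N = n * K + 1.  Forward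
    recursion gives l' u <= t ^ (u - 1) * l u, and backward recursion from N
    gives r' u <= t ^ (N - u + 1) * r u; at vertex 1 the latter forces
    1 <= t, and the product bounds the total mass, Z' <= t ^ N * Z
    ([ratio_ge1], [mass_upper]).  Everything thus hinges on t ^ N tending
    to 1, that is, on t - 1 being of smaller order than 1 / n, since N grows
    linearly in n thanks to the bounded jumps.

    Let s n be the probability that the chain of G started at 1 has not
    returned to 1 after n steps.  The simple cycles of length at most n survive
    in the subgraph, where each weighs at least t times as much, so
    t * (1 - s n) <= 1 ([ratio_survival_le1]).  The sum of all s n is at most
    Z, because a mass l 1 * s n is lost at vertex 1 at each step, and s is
    nonincreasing; hence n * s n tends to 0 ([survival1_small]).  Bernoulli's
    inequality then gives t ^ N * (1 - N * s n) <= 1.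

    Moreover l <= l' on the vertices up to n, and r' dominates the part of r
    due to returns to 1 within the subgraph, a part that increases to r
    ([left_lower], [right_lower], [survival_cvg0]).  Together these bound the
    measures of a cylinder below by a sequence tending to its measure for G
    ([cylinder_weight_lower], [lower_limit_cylinder]).

    Lower bounds suffice, as no mass can appear elsewhere: a nonnegative
    continuous function is the increasing limit of its infima over the windows
    of a trajectory, and these are countable combinations of cylinders, so the
    lower limit of its integrals is at least the limit integral; applied to
    M + f and M - f this is weak convergence ([portmanteau],
    [weak_cvg_cylinder]). *)

(** * Lower semicontinuity of integrals and weak convergence *)

Section AsymptoticLowerBound.
Context {R : realType}.
Implicit Types (a c : \bar R) (b d : nat -> \bar R).

(** For bounded sequences this says that the lower limit of b is at least a;
    the epsilon form adds up along finite sums without any finiteness check. *)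
Definition lower_limit_ge a b :=
  forall e : R, 0 < e -> \forall n \near \oo, (a <= b n + e%:E)%E.

Lemma lower_limit_geD a b c d :
  lower_limit_ge a b -> lower_limit_ge c d ->
  lower_limit_ge (a + c)%E (fun n => b n + d n)%E.
Proof.
move=> ab cd e e0.
have [e2 e2'] : 0 < e / 2 /\ e = e / 2 + e / 2 by lra.
near=> n; rewrite [e]e2' EFinD addeACA; apply: leeD.
  by near: n; exact: ab.
by near: n; exact: cd.
Unshelve. all: by end_near. Qed.

Lemma lower_limit_geZ (r : R) a b : 0 <= r ->
  lower_limit_ge a b -> lower_limit_ge (r%:E * a)%E (fun n => r%:E * b n)%E.
Proof.
move=> r0 ab e e0.
have r1 : 0 < r + 1 by lra.
have er : 0 < e / (r + 1) by exact: divr_gt0.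
near=> n; apply: (@le_trans _ _ (r%:E * (b n + (e / (r + 1))%:E))%E).
  by apply: lee_wpmul2l; rewrite ?lee_fin//; near: n; exact: ab.
rewrite muleDr ?fin_num_adde_defl//; apply: leeD => //.
by rewrite -EFinM lee_fin mulrA ler_pdivrMr// mulrC ler_wpM2l ?ltW//; lra.
Unshelve. all: by end_near. Qed.

Lemma lower_limit_ge_sum (f : nat -> \bar R) (g : nat -> nat -> \bar R) N :
  (forall k, lower_limit_ge (f k) (g ^~ k)) ->
  lower_limit_ge (\sum_(0 <= k < N) f k)%E (fun n => \sum_(0 <= k < N) g n k)%E.
Proof.
move=> fg; elim: N => [|N IH].
  move=> e e0; apply: nearW => n.
  by rewrite !big_geq// add0e lee_fin ltW.
rewrite big_nat_recr//=.
rewrite (_ : (fun n => _) = fun n => (\sum_(0 <= k < N) g n k + g n N)%E).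
  exact: lower_limit_geD.
by apply/funext => n; rewrite big_nat_recr.
Qed.

Lemma cvge_almost_le (u : nat -> \bar R) a (e : R) :
  a \is a fin_num -> 0 < e -> u @ \oo --> a ->
  exists n, (a <= u n + e%:E)%E.
Proof.
move=> fin e0 ua; apply: contrapT => /forallNP noN.
have : (a <= a - e%:E)%E.
  apply: (cvge_to_le ua); apply: nearW => n; rewrite leeBrDr//.
  by have /negP := noN n; rewrite -ltNge => /ltW.
by rewrite -(fineK fin) -EFinB lee_fin => ?; lra.
Qed.

End AsymptoticLowerBound.

Section Portmanteau.
Context {R : realType} {d : measure_display} {T : measurableType d}.
Variables (nu : nat -> probability T R) (mu : probability T R) (D : set T).
Hypothesis mD : measurable D.

Let fiber (q : T -> nat) k := D `&` q @^-1` [set k].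

Let D_fiber q : D = \bigcup_k fiber q k.
Proof.
by apply/seteqP; split => [w Dw|w [k _ []]//]; exists (q w).
Qed.

Let trivIset_fiber q : trivIset setT (fiber q).
Proof.
apply/trivIsetP => i j _ _ ij; apply/seteqP; split => // w [[_ qi] [_ qj]].
by move: ij; rewrite -qi -qj eqxx.
Qed.

Lemma measurable_fun_fiber q (g : T -> R) :
  (forall k, measurable (fiber q k)) ->
  (forall w w', D w -> D w' -> q w = q w' -> g w = g w') ->
  measurable_fun D g.
Proof.
move=> mF gq _ Y mY.
pose S := [set k | exists2 w, fiber q k w & Y (g w)].
have -> : D `&` g @^-1` Y = \bigcup_(k in S) fiber q k.
  apply/seteqP; split => [w [Dw Yw]|w [k [w' [Dw' qw'] Yw'] [Dw qw]]].
    by exists (q w) => //; exists w.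
  by split => //=; rewrite (gq w w')// qw qw'.
by apply: bigcup_measurable => k _.
Qed.

Lemma fin_num_bounded_integral (m : probability T R) (g : T -> R) (C : R) :
  measurable_fun D g -> (forall w, D w -> 0 <= g w <= C) ->
  (\int[m]_(w in D) (g w)%:E)%E \is a fin_num.
Proof.
move=> mg gC; rewrite ge0_fin_numE; last first.
  by apply: integral_ge0 => w /gC/andP[]; rewrite lee_fin.
apply: (@le_lt_trans _ _ (\int[m]_(w in D) (cst C%:E) w)%E).
  apply: ge0_le_integral => //; first by move=> w /gC/andP[]; rewrite lee_fin.
    exact/measurable_EFinP.
  by move=> w /gC/andP[]; rewrite lee_fin.
by rewrite integral_cst// ltey_eq fin_numM// fin_num_measure.
Qed.

(** A bounded nonnegative function with countably many values splits the
    integral into a series over its level sets; a finite partial sum already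
    carries almost all of the limit integral, and only the lower bounds on the
    measures of finitely many level sets matter for it. *)
Lemma lower_limit_ge_integral_fiber q (g : T -> R) (C : R) :
  (forall k, measurable (fiber q k)) ->
  (forall w w', D w -> D w' -> q w = q w' -> g w = g w') ->
  (forall w, D w -> 0 <= g w <= C) ->
  (forall k, lower_limit_ge (mu (fiber q k)) (fun n => nu n (fiber q k))) ->
  lower_limit_ge (\int[mu]_(w in D) (g w)%:E)%E
    (fun n => \int[nu n]_(w in D) (g w)%:E)%E.
Proof.
move=> mF gq gC muF e e0.
have mg := measurable_fun_fiber mF gq.
have /choice[c cP] k : exists c : R, 0 <= c /\ forall w, fiber q k w -> g w = c.
  have [[w [Dw qw]]|nw] := pselect (fiber q k !=set0).
    exists (g w); split; first by case/andP: (gC _ Dw).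
    by move=> w' [Dw' qw']; apply: gq => //; rewrite qw qw'.
  by exists 0; split => // w Fw; case: nw; exists w.
have intE (m : probability T R) :
    (\int[m]_(w in D) (g w)%:E = \sum_(k <oo) (c k)%:E * m (fiber q k))%E.
  rewrite [in LHS](D_fiber q) ge0_integral_bigcup//=.
  - apply: eq_eseriesr => k _; rewrite -integral_cst//.
    by apply: eq_integral => w /[!inE] /(proj2 (cP k)) ->.
  - by rewrite -D_fiber; exact/measurable_EFinP.
  - by move=> w; rewrite -D_fiber lee_fin => /gC/andP[].
have ge0 (m : probability T R) k : (0 <= (c k)%:E * m (fiber q k))%E.
  by apply: mule_ge0 => //; rewrite lee_fin; case: (cP k).
have [N hN] : exists N, (\int[mu]_(w in D) (g w)%:E <=
    \sum_(0 <= k < N) (c k)%:E * mu (fiber q k) + (e / 2)%:E)%E.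
  apply: cvge_almost_le; [|lra|].
    by apply: (fin_num_bounded_integral _ mg gC).
  by rewrite intE; apply: is_cvg_nneseries.
have e2 : 0 < e / 2 by lra.
near=> n; apply: (le_trans hN).
rewrite [in leRHS](splitr e) EFinD addeA leeD2r//.
apply: (@le_trans _ _
  (\sum_(0 <= k < N) (c k)%:E * nu n (fiber q k) + (e / 2)%:E)%E).
  near: n; apply: (@lower_limit_ge_sum _ (fun k => (c k)%:E * mu (fiber q k))%E
    (fun n k => (c k)%:E * nu n (fiber q k))%E) => // k.
  by apply: lower_limit_geZ => //; case: (cP k).
by rewrite intE leeD2r// nneseries_lim_ge.
Unshelve. all: by end_near. Qed.

(** The number q m w codes what is observed of w at resolution m, a datum with
    countably many values. *)
Variable q : nat -> T -> nat.
Hypothesis mq : forall m k, measurable (fiber (q m) k).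
Hypothesis q_refine : forall m w w', q m.+1 w = q m.+1 w' -> q m w = q m w'.
Hypothesis muq : forall m k,
  lower_limit_ge (mu (fiber (q m) k)) (fun n => nu n (fiber (q m) k)).

Definition q_continuous (g : T -> R) := forall w e, D w -> 0 < e ->
  exists m, forall w', D w' -> q m w' = q m w -> `|g w' - g w| <= e.

Section LowerEnvelope.
Variables (g : T -> R) (C : R).
Hypothesis gC : forall w, D w -> 0 <= g w <= C.

Let level m w := [set g w' | w' in [set w' | D w' /\ q m w' = q m w]].
Let env m w := inf (level m w).

Let level_lb m w : lbound (level m w) 0.
Proof. by move=> _ [w' [/gC/andP[? _] _]] <-. Qed.

Let env_le m w : D w -> env m w <= g w.
Proof.
by move=> Dw; apply: ge_inf; [exists 0; exact: level_lb|exists w].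
Qed.

Let le_env m w a : D w -> (forall w', D w' -> q m w' = q m w -> a <= g w') ->
  a <= env m w.
Proof.
move=> Dw aP; apply: lb_le_inf; first by exists (g w), w.
by move=> _ [w' [Dw' qw'] <-]; exact: aP.
Qed.

Let env_bounds m w : D w -> 0 <= env m w <= C.
Proof.
move=> Dw; rewrite le_env//=; last by move=> w' /gC/andP[].
by rewrite (le_trans (env_le _ Dw))//; case/andP: (gC Dw).
Qed.

Let env_q m w w' : D w -> D w' -> q m w = q m w' -> env m w = env m w'.
Proof. by move=> Dw Dw' qw; rewrite /env /level qw. Qed.

Let q_mono m n w w' : (m <= n)%N -> q n w = q n w' -> q m w = q m w'.
Proof.
by move=> /subnK <-; elim: (n - m)%N => // k IH /q_refine; exact: IH.
Qed.

Let env_nd w : D w -> nondecreasing_seq (env ^~ w).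
Proof.
move=> Dw m n mn; apply: le_env => // w' Dw' /(q_mono mn) qw'.
by apply: ge_inf; [exists 0; exact: level_lb|exists w'].
Qed.

Let env_cvg w : q_continuous g -> D w -> env ^~ w @ \oo --> g w.
Proof.
move=> cg Dw; apply/cvgrPdist_le => e e0; have [m hm] := cg _ _ Dw e0.
near=> n; have mn : (m <= n)%N by near: n; exists m.
rewrite ger0_norm ?subr_ge0 ?env_le// lerBlDr -lerBlDl.
apply: le_env => // w' Dw' /(q_mono mn) /(hm _ Dw').
by rewrite ler_distl => /andP[].
Unshelve. all: by end_near. Qed.

Let measurable_env m : measurable_fun D (env m).
Proof. by apply: (measurable_fun_fiber (mq m)) => w w'; exact: env_q. Qed.

Lemma q_continuous_measurable : q_continuous g -> measurable_fun D g.
Proof.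
move=> cg; apply: (measurable_fun_cvg (h := env)) => // w; exact: env_cvg.
Qed.

(** The infima of g over the fibers of q m increase to g by continuity, so
    monotone convergence reduces the claim to functions constant on fibers. *)
Lemma lower_limit_ge_integral : q_continuous g ->
  lower_limit_ge (\int[mu]_(w in D) (g w)%:E)%E
    (fun n => \int[nu n]_(w in D) (g w)%:E)%E.
Proof.
move=> cg e e0.
have mg := q_continuous_measurable cg.
have [m hm] : exists m, (\int[mu]_(w in D) (g w)%:E <=
    \int[mu]_(w in D) (env m w)%:E + (e / 2)%:E)%E.
  apply: cvge_almost_le; [exact: (fin_num_bounded_integral _ mg gC)|lra|].
  have -> : (\int[mu]_(w in D) (g w)%:E =
      \int[mu]_(w in D) (limn (fun m => (env m w)%:E)))%E.
    apply: eq_integral => w /[!inE] Dw; apply/esym/cvg_lim => //.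
    by apply: cvg_EFin; [exact: nearW|exact: env_cvg].
  apply: cvg_monotone_convergence => //.
  - by move=> m; exact/measurable_EFinP.
  - by move=> m w /(@env_bounds m)/andP[]; rewrite lee_fin.
have := lower_limit_ge_integral_fiber (mq m) (@env_q m) (@env_bounds m) (muq m).
have e2 : 0 < e / 2 by lra.
move=> /(_ _ e2); apply: filterS => n env_lower; apply: (le_trans hm).
rewrite [in leRHS](splitr e) EFinD addeA leeD2r//.
apply: (@le_trans _ _ (\int[nu n]_(w in D) (env m w)%:E + (e / 2)%:E)%E).
  exact: env_lower.
rewrite leeD2r//; apply: ge0_le_integral => //.
- by move=> w /(@env_bounds m)/andP[]; rewrite lee_fin.
- exact/measurable_EFinP.
- exact/measurable_EFinP.
- by move=> w Dw; rewrite lee_fin env_le.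
Qed.

End LowerEnvelope.

(** The lower bound applied to M + f and to M - f gives both halves of the
    convergence, since all the measures give D the same finite mass. *)
Theorem portmanteau (f : T -> R) (M : R) :
  mu D = 1%E -> (forall n, nu n D = 1%E) ->
  q_continuous f -> (forall w, D w -> `|f w| <= M) ->
  (\int[nu n]_(w in D) (f w)%:E)%E @[n --> \oo] -->
    (\int[mu]_(w in D) (f w)%:E)%E.
Proof.
move=> muD nuD cf fM.
pose g (s : R) w := M + s * f w.
have gM s : s = 1 \/ s = -1 -> forall w, D w -> 0 <= g s w <= M + M.
  move=> s1 w /fM; rewrite /g ler_norml => /andP[].
  by case: s1 => ->; rewrite ?mul1r ?mulN1r => ? ?; apply/andP; split; lra.
have cg s : s = 1 \/ s = -1 -> q_continuous (g s).
  move=> s1 w e Dw e0; have [m hm] := cf w e Dw e0; exists m => w' Dw' qw.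
  rewrite /g opprD addrACA subrr add0r -mulrBr normrM.
  suff -> : `|s| = 1 by rewrite mul1r hm.
  by case: s1 => ->; rewrite ?normrN normr1.
have mg s : s = 1 \/ s = -1 -> measurable_fun D (g s).
  by move=> s1; exact: (q_continuous_measurable (gM s s1) (cg s s1)).
have mf : measurable_fun D f.
  have -> : f = fun w => g 1 w - M by apply/funext => w; rewrite /g; lra.
  by apply: measurable_funB => //; apply: mg; left.
have intf (m : probability T R) : m.-integrable D (EFin \o f).
  apply: measurable_bounded_integrable => //.
    by rewrite ltey_eq fin_num_measure.
  by exists M; split => //= a Ma w Dw; rewrite (le_trans (fM _ Dw))// ltW.
have intg s (m : probability T R) : m D = 1%E ->
    (\int[m]_(w in D) (g s w)%:E =
      (M + s * fine (\int[m]_(w in D) (f w)%:E))%:E)%E.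
  move=> mD1; rewrite /g; under eq_integral do rewrite EFinD EFinM.
  rewrite integralD//=; last 2 first.
  - exact: (finite_measure_integrable_cst m M mD).
  - exact: (integrableZl mD s (intf m)).
  rewrite (integralZl mD (intf m)) [X in (X + _)%E](_ : _ = M%:E); last first.
    by rewrite -[RHS]mule1 -mD1; exact: (integral_cst m mD M%:E).
  rewrite EFinD EFinM fineK//.
  exact: (integrable_fin_num mD (intf m)).
have lower s : s = 1 \/ s = -1 ->
    forall e, 0 < e -> \forall n \near \oo,
      s * fine (\int[mu]_(w in D) (f w)%:E)%E <=
      s * fine (\int[nu n]_(w in D) (f w)%:E)%E + e.
  move=> s1 e e0.
  have := lower_limit_ge_integral (gM s s1) (cg s s1) e0.
  apply: filterS => n; rewrite !intg// -EFinD lee_fin; lra.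
rewrite -(fineK (integrable_fin_num mD (intf mu))).
apply/fine_cvgP; split.
  by apply: nearW => n; exact: (integrable_fin_num mD (intf _)).
apply/cvgrPdist_le => e e0; near=> n; rewrite ler_distl /=.
have h1 : fine (\int[mu]_(w in D) (f w)%:E)%E <=
    fine (\int[nu n]_(w in D) (f w)%:E)%E + e.
  rewrite -[leLHS]mul1r -[X in X + _]mul1r; near: n.
  by apply: lower => //; left.
have h2 : - fine (\int[mu]_(w in D) (f w)%:E)%E <=
    - fine (\int[nu n]_(w in D) (f w)%:E)%E + e.
  rewrite -[leLHS]mulN1r -[X in X + _]mulN1r; near: n.
  by apply: lower => //; right.
by apply/andP; split; lra.
Unshelve. all: by end_near. Qed.

End Portmanteau.
Section Trajectories.
Context {R : realType}.
Implicit Types (G : digraph) (w : int -> nat).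

Lemma measurable_cylinder s x : measurable (cylinder s x : set trajectories).
Proof. by apply: sub_sigma_algebra; exists s, x. Qed.

Lemma measurable_Omega G : measurable (Omega G : set trajectories).
Proof.
pose edge_at (i : int) (n : nat) : set trajectories :=
  if unpickle n is Some e then
    if `[< edges G e >] then cylinder i [:: e.1; e.2] else set0
  else set0.
pose E n : set trajectories :=
  if unpickle n is Some i then \bigcup_k edge_at i k else setT.
rewrite (_ : Omega G = \bigcap_n E n).
  apply: bigcapT_measurable => n; rewrite /E.
  case: (unpickle n) => [i|//]; apply: bigcupT_measurable => k.
  rewrite /edge_at; case: (unpickle k) => [e|//].
  by case: ifP => // _; exact: measurable_cylinder.
apply/seteqP; split => [w Gw n _|w Ew i].
  rewrite /E; case: (unpickle n) => [i|//].
  exists (pickle (w i, w (i + 1))) => //.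
  rewrite /edge_at pickleK asboolT//= => -[|[|//]] _ //=.
  by rewrite addr0.
have := Ew (pickle i) Logic.I; rewrite /E pickleK => -[k _].
rewrite /edge_at; case: (unpickle k) => [[a b]|//].
case: ifP => // /asboolP Gab wab.
by have := wab 0%N isT; have := wab 1%N isT; rewrite /= addr0 => -> ->.
Qed.

Definition window (m : nat) w : seq nat :=
  mkseq (fun i => w (- m%:Z + i%:Z)) (m + m).+1.

Lemma eq_windowP m w w' :
  window m w = window m w' <->
  forall t : int, (absz t <= m)%N -> w t = w' t.
Proof.
split => [ww' t tm|ww'].
  have it : (absz (t + m%:Z)%R < (m + m).+1)%N by lia.
  have := congr1 (nth 0%N ^~ (absz (t + m%:Z))) ww'.
  rewrite /= !nth_mkseq//; suff -> : - m%:Z + (absz (t + m%:Z))%:Z = t by [].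
  by lia.
by apply/eq_in_map => i; rewrite mem_iota => im; apply: ww'; lia.
Qed.

Lemma window_cylinder m w :
  [set w' | window m w' = window m w] = cylinder (- m%:Z) (window m w).
Proof.
apply/seteqP; split => [w' E i|w' E].
  by rewrite size_mkseq => im; rewrite -E nth_mkseq.
apply: (@eq_from_nth _ 0%N); rewrite !size_mkseq// => i im.
by rewrite -E ?size_mkseq// nth_mkseq.
Qed.

(** In the product of discrete spaces the windows around the origin form a
    neighbourhood basis. *)
Lemma ptws_window (w : {ptws int -> nat}) (A : set {ptws int -> nat}) :
  nbhs w A ->
  exists m, forall w' : int -> nat, window m w' = window m w -> A w'.
Proof.
pose F : set_system (int -> nat) :=
  [set B | exists m, forall w', window m w' = window m w -> B w'].
have FF : Filter F.
  split.
  - by exists 0%N.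
  - move=> B C [m mB] [n nC]; exists (maxn m n) => w' /eq_windowP E.
    by split; [apply: mB|apply: nC]; apply/eq_windowP => t tm; apply: E; lia.
  - by move=> B C BC [m mB]; exists m => w' /mB /BC.
have : {ptws, F --> (w : int -> nat)}.
  apply/(@pointwise_cvgP (discrete_topology int) nat F w FF) => t.
  apply/discrete_cvg.
  by exists (absz t) => w' /eq_windowP; exact.
by move=> /(_ A) h /h.
Qed.

Lemma weak_cvg_cylinder G (mu_ : nat -> probability trajectories R)
    (mu : probability trajectories R) :
  (forall k, mu_ k (Omega G) = 1%E) -> mu (Omega G) = 1%E ->
  (forall s u p w, Omega G w -> cylinder s (u :: p) w ->
    lower_limit_ge (mu (cylinder s (u :: p)))
      (fun k => mu_ k (cylinder s (u :: p)))) ->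
  weak_cvg G mu_ mu.
Proof.
move=> mu_G muG lower f cf [M fM].
have mG := measurable_Omega G.
have muI (m : probability trajectories R) (A : set trajectories) :
    m (Omega G) = 1%E ->
    measurable A -> m (Omega G `&` A) = m A.
  move=> mG1 mA; rewrite -[in RHS](setTI A) -(setUv (Omega G)) setIUl.
  rewrite measureU//; [|exact: measurableI
    |exact: (measurableI _ _ (measurableC mG))|]; last first.
    by rewrite setIACA setICr set0I.
  rewrite [X in (_ + X)%E](_ : _ = 0%E) ?adde0//.
  apply/eqP; rewrite eq_le measure_ge0 andbT.
  rewrite (@le_trans _ _ (m (~` Omega G)))//.
    apply: le_measure; rewrite ?inE//; last exact: measurableC.
    by apply: measurableI => //; exact: measurableC.
  by rewrite probability_setC// mG1 subee.
pose q (m : nat) (w : trajectories) : nat := pickle (window m w).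
have q_window m w w' : q m w = q m w' <-> window m w = window m w'.
  by split; [exact: (pcan_inj pickleK)|rewrite /q => ->].
have fiberE m k : (Omega G `&` q m @^-1` [set k] !=set0) ->
    exists2 w, Omega G w &
    Omega G `&` q m @^-1` [set k] = Omega G `&` cylinder (- m%:Z) (window m w).
  move=> [w [Gw /= qw]]; exists w => //; rewrite -window_cylinder.
  congr (_ `&` _); apply/seteqP; split => w' /=; rewrite -qw.
    by move/q_window.
  by move=> h; apply/q_window.
apply: (@portmanteau _ _ _ mu_ mu (Omega G) mG q _ _ _ f M) => //.
- move=> m k; have [/fiberE[w Gw ->]|/set0P/negP/negPn/eqP ->//] :=
    pselect (Omega G `&` q m @^-1` [set k] !=set0).
  by apply: measurableI => //; exact: measurable_cylinder.
- move=> m w w' /q_window/eq_windowP E; apply/q_window/eq_windowP => t tm.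
  by apply: E; lia.
- move=> m k; have [/fiberE[w Gw ->]|/set0P/negP/negPn/eqP ->] :=
    pselect (Omega G `&` q m @^-1` [set k] !=set0).
    rewrite muI//; last exact: measurable_cylinder.
    rewrite (_ : (fun n => _) =
        fun n => mu_ n (cylinder (- m%:Z) (window m w))).
      by apply: (lower _ _ _ w) => //; rewrite -window_cylinder.
    by apply/funext => n; rewrite muI//; exact: measurable_cylinder.
  move=> e e0; apply: nearW => n.
  by rewrite !measure0 add0e lee_fin ltW.
move=> w e Gw e0; move/subspace_continuousP : cf => /(_ w Gw).
move=> /cvgrPdist_le /(_ e e0) /ptws_window[m hm].
by exists m => w' Gw' /q_window /hm /(_ Gw'); rewrite distrC.
Qed.

End Trajectories.

(** * Comparison of normalised eigenvectors *)

Lemma ler_sum_nat_support {R : numDomainType} (F : nat -> R) a b c d :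
  (forall i, 0 <= F i) ->
  (forall i, (a <= i < b)%N -> F i != 0 -> (c <= i < d)%N) ->
  \sum_(a <= i < b) F i <= \sum_(c <= i < d) F i.
Proof.
move=> F0 Fsupp.
rewrite (big_nat_widenl a 0)// (big_nat_widen 0 b (maxn b d)) ?leq_maxl//.
rewrite [leRHS](big_nat_widenl c 0)//.
rewrite [leRHS](big_nat_widen 0 d (maxn b d)) ?leq_maxr//.
rewrite big_mkcond [leRHS]big_mkcond /=; apply: ler_sum => i _.
case: (F i =P 0) => [->|/eqP Fi]; first by rewrite !if_same.
case: ifPn => [Hi|_]; last by case: ifP.
by rewrite ifT//; have := Fsupp i ^~ Fi; lia.
Qed.

Section Comparison.
Context {R : realType}.
Implicit Types (A B : nat -> nat -> R) (l r f : nat -> R) (rho : R).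

(** The only backward steps lead to vertex 1, so the left equation at v >= 2
    and the sum over v >= 2 in the right equation involve forward steps only,
    which is what makes induction along the vertices possible.  Here rho is the
    inverse of the Perron eigenvalue. *)
Record eigenpair A (K : nat) rho l r : Prop := {
  eigen_K_gt0 : (0 < K)%N;
  eigen_A_ge0 : forall u v, 0 <= A u v;
  eigen_band : forall u v, A u v != 0 -> v = 1%N \/ (u < v < u + K)%N;
  eigen_rho_gt0 : 0 < rho;
  eigen_l_ge0 : forall u, 0 <= l u;
  eigen_r_ge0 : forall u, 0 <= r u;
  eigen_l1 : l 1%N = 1;
  eigen_r1 : r 1%N = 1;
  eigen_left : forall v, (2 <= v)%N ->
    l v = rho * \sum_(1 <= u < v) l u * A u v;
  eigen_right : forall u,
    r u = rho * (A u 1%N + \sum_(2 <= v < u + K) A u v * r v) }.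

(** For f = r this is the r-mass carried by the continuations from u that
    do not step to vertex 1. *)
Definition avoid A (K : nat) rho f u :=
  rho * \sum_(2 <= v < u + K) A u v * f v.

Section Survival.
Variables (A : nat -> nat -> R) (K : nat) (rho : R) (l r : nat -> R).
Hypothesis E : eigenpair A K rho l r.
Let A0 := eigen_A_ge0 E.
Let rho0 := eigen_rho_gt0 E.
Let l0 := eigen_l_ge0 E.
Let r0 := eigen_r_ge0 E.
Local Notation T := (avoid A K rho).

(** With r normalised at vertex 1, this is the probability, times r u, that
    the stationary chain started at u does not hit 1 during m steps. *)
Definition survival m := iter m T r.

Lemma avoid_ge0 f : (forall u, 0 <= f u) -> forall u, 0 <= T f u.
Proof.
move=> f0 u; apply: mulr_ge0; first exact: ltW.
by apply: sumr_ge0 => v _; exact: mulr_ge0.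
Qed.

Lemma le_avoid f g : (forall u, f u <= g u) -> forall u, T f u <= T g u.
Proof.
move=> fg u; rewrite /avoid ler_pM2l//; apply: ler_sum => v _.
by rewrite ler_wpM2l.
Qed.

Lemma survival_ge0 m u : 0 <= survival m u.
Proof. by elim: m u => [|m IH] u; [exact: r0|exact: avoid_ge0]. Qed.

Lemma survival_decr m u : survival m.+1 u <= survival m u.
Proof.
elim: m u => [|m IH] u; last exact: le_avoid.
by rewrite /= /avoid [leRHS](eigen_right E) ler_pM2l// lerDr A0.
Qed.

Lemma survival_anti m n u : (m <= n)%N -> survival n u <= survival m u.
Proof.
move=> /subnK <-; elim: (n - m)%N => // k IH.
by rewrite addSn (le_trans (survival_decr _ _)).
Qed.

Lemma survival_le m u : survival m u <= r u.
Proof. exact: (@survival_anti 0). Qed.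

Lemma survivalS m u :
  r u - survival m.+1 u =
  rho * (A u 1%N + \sum_(2 <= v < u + K) A u v * (r v - survival m v)).
Proof.
rewrite [in LHS](eigen_right E) [survival _ _]/= /avoid -mulrBr; congr (_ * _).
rewrite -addrA; congr (_ + _); rewrite -sumrB.
by apply: eq_bigr => v _; rewrite mulrBr.
Qed.

(** The left equation turns the operator T into a shift: mass at u moves to
    some larger vertex, less than K further, and none of it reaches vertex 1. *)
Lemma left_avoid_le f a M : (0 < a)%N -> (forall u, 0 <= f u) ->
  \sum_(a <= u < M) l u * T f u <= \sum_(a.+1 <= u < M + K) l u * f u.
Proof.
move=> a0 f0.
pose g u v := rho * (l u * A u v) * f v.
have g0 u v : 0 <= g u v by rewrite mulr_ge0// mulr_ge0 ?(ltW rho0)// mulr_ge0.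
have g_band u v : g u v != 0 -> v = 1%N \/ (u < v < u + K)%N.
  rewrite !mulf_eq0 !negb_or => /andP[/andP[_ /andP[_ +]] _].
  exact: (eigen_band E).
apply: (@le_trans _ _ (\sum_(a <= u < M) \sum_(a.+1 <= v < M + K) g u v)).
  rewrite big_nat [leRHS]big_nat; apply: ler_sum => u /andP[au uM].
  rewrite /avoid mulrA mulr_sumr.
  rewrite (eq_bigr (g u)) => [|v _]; last first.
    by rewrite /g; ring.
  by apply: ler_sum_nat_support => // v v2 /g_band; lia.
rewrite exchange_big_nat /= big_nat [leRHS]big_nat.
apply: ler_sum => v /andP[av vM].
rewrite -mulr_suml ler_wpM2r// -mulr_sumr (eigen_left E); last by lia.
rewrite ler_pM2l//; apply: ler_sum_nat_support => [u|u uM].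
  by rewrite mulr_ge0.
by rewrite mulf_eq0 negb_or => /andP[_ /(eigen_band E)]; lia.
Qed.

(** Iterating the shift h times, the mass that has avoided vertex 1 ends up
    beyond vertex h, in the tail of the total mass. *)
Lemma left_survival_tail h M :
  \sum_(1 <= u < M) l u * survival h u <=
  \sum_(h.+1 <= u < M + h * K) l u * r u.
Proof.
suff: forall a, (0 < a)%N -> \sum_(a <= u < M) l u * survival h u <=
    \sum_(a + h <= u < M + h * K) l u * r u by move=> H; exact: (H 1%N isT).
rewrite /survival; elim: h (r) r0 M => [|h IH] f f0 M a a0.
  by rewrite addn0 mul0n addn0.
rewrite iterSr.
apply: (le_trans (IH _ (avoid_ge0 f0) _ _ a0)).
apply: (le_trans (left_avoid_le _ _ f0)); first by lia.
by rewrite addnS mulSn addnA addnAC.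
Qed.

(** Vertex 1 is never entered by T, so each application of T loses the mass
    that was there; the total loss is at most the initial mass. *)
Lemma sum_survival_le h n :
  \sum_(h <= j < h + n) survival j 1%N <=
  \sum_(1 <= u < (n * K).+1) l u * survival h u.
Proof.
suff H f : (forall u, 0 <= f u) -> forall M, (0 < M)%N ->
    \sum_(0 <= j < n) iter j T f 1%N + \sum_(1 <= u < M) l u * iter n T f u <=
    \sum_(1 <= u < M + n * K) l u * f u.
  have := H (survival h) (survival_ge0 h) 1%N isT.
  rewrite [X in _ + X]big_geq// addr0 add1n; apply: le_trans.
  rewrite -{1}[h]add0n big_addn addKn.
  by apply: ler_sum => j _; rewrite /survival -iterD.
elim: n f => [|n IH] f f0 M M0.
  by rewrite big_geq// add0r mul0n addn0.
rewrite big_nat_recl//= -addrA.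
under eq_bigr do rewrite -iterS iterSr.
under [X in _ + (_ + X)]eq_bigr do rewrite -iterS iterSr.
have Mn : (0 < M + n * K)%N by lia.
apply: (@le_trans _ _ (f 1%N + \sum_(1 <= u < M + n * K) l u * T f u)).
  by rewrite lerD2l IH//; exact: avoid_ge0.
rewrite [leRHS]big_ltn ?(eigen_l1 E) ?mul1r; last by have := eigen_K_gt0 E; lia.
rewrite lerD2l (_ : M + n.+1 * K = M + n * K + K)%N; last by rewrite mulSn; lia.
exact: left_avoid_le.
Qed.

Hypothesis l_gt0 : forall u, (0 < u)%N -> 0 < l u.
Hypothesis lr_summable : forall e, 0 < e ->
  exists a, forall M, \sum_(a <= u < M) l u * r u <= e.

Lemma survival_mass_small e : 0 < e -> exists h0, forall h M, (h0 <= h)%N ->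
  \sum_(1 <= u < M) l u * survival h u <= e.
Proof.
move=> /lr_summable[a aP]; exists a => h M ah.
apply: (le_trans (left_survival_tail h M)).
apply: (le_trans _ (aP (M + h * K)%N)).
by apply: ler_sum_nat_support => [u|u uM _]; [exact: mulr_ge0|lia].
Qed.

Lemma survival_cvg0 u : (0 < u)%N -> survival ^~ u @ \oo --> (0 : R).
Proof.
move=> u0; apply/cvgrPdist_le => e e0.
have [h0 h0P] := survival_mass_small (mulr_gt0 e0 (l_gt0 u0)).
near=> h; rewrite sub0r normrN ger0_norm ?survival_ge0//.
have : \sum_(1 <= v < u.+1) l v * survival h v <= e * l u.
  by apply: h0P; near: h; exists h0.
rewrite big_nat_recr//=.
apply: contraLR; rewrite -!ltNge => hu.
rewrite mulrC ltr_wpDl//; last by rewrite ltr_pM2l// l_gt0.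
by apply: sumr_ge0 => v _; rewrite mulr_ge0// survival_ge0.
Unshelve. all: by end_near. Qed.

(** Being nonincreasing and summable, the survival probabilities from vertex 1
    are of smaller order than 1 / n. *)
Lemma survival1_small : (fun n => n%:R * survival n 1%N) @ \oo --> (0 : R).
Proof.
apply/cvgrPdist_le => e e0.
have [h h_small] := survival_mass_small (divr_gt0 e0 (ltr0n R 2)).
near=> n.
have hn : (h + h <= n)%N by near: n; exists (h + h)%N.
rewrite sub0r normrN ger0_norm; last by rewrite mulr_ge0 ?survival_ge0.
have : (n - h)%:R * survival n 1%N <= e / 2.
  apply: (le_trans _ (h_small h (((n - h) * K).+1)%N (leqnn h))).
  apply: (le_trans _ (sum_survival_le h (n - h))).
  rewrite subnKC; last by lia.
  rewrite -[X in X%:R]card_ord mulr_natl.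
  rewrite (_ : _ *+ _ = \sum_(h <= j < n) survival n 1%N); last first.
    by rewrite sumr_const_nat card_ord.
  rewrite big_nat [leRHS]big_nat; apply: ler_sum => j jn.
  by apply: survival_anti; lia.
apply: contraLR; rewrite -!ltNge => he.
have : n%:R <= 2 * (n - h)%:R :> R by rewrite -natrM ler_nat; lia.
have := survival_ge0 n 1%N.
by nra.
Unshelve. all: by end_near. Qed.

End Survival.

Section Subgraph.
Variables (A B : nat -> nat -> R) (K : nat).
Variables (rho rho' : R) (l r l' r' : nat -> R).
Hypothesis E : eigenpair A K rho l r.
Hypothesis E' : eigenpair B K rho' l' r'.
Hypothesis BA : forall u v, B u v <= A u v.
Let t := rho' / rho.

Let rho0 := eigen_rho_gt0 E.
Let t0 : 0 < t. Proof. exact: divr_gt0 (eigen_rho_gt0 E') rho0. Qed.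
Let rhoE : rho' = t * rho. Proof. by rewrite /t divfK// gt_eqF. Qed.

Section Upper.
Variable N : nat.
Hypothesis N0 : (0 < N)%N.
Hypothesis r'_supp : forall u, (N < u)%N -> r' u = 0.

(** Each step contributes one factor t, and a path avoiding vertex 1 climbs
    at every step, so it makes at most N - u steps inside the subgraph before
    the one that returns.  The number m stands for the maximum of 1 and t. *)
Let right_upper_max m u : 1 <= m -> t <= m -> (u <= N)%N ->
  r' u <= t * (m ^+ (N - u) * r u).
Proof.
move=> m1 tm; have m0 : 0 <= m by exact: le_trans m1.
have [j] := ubnP (N - u)%N; elim: j u => // j IH u; rewrite ltnS => uj uN.
rewrite (eigen_right E) (eigen_right E') rhoE -mulrA ler_pM2l//.
rewrite mulrCA ler_pM2l// mulrDr mulr_sumr; apply: lerD.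
  by rewrite (le_trans (BA _ _))// ler_peMl ?(eigen_A_ge0 E) ?exprn_ege1.
rewrite big_nat [leRHS]big_nat; apply: ler_sum => v v2.
have Arv0 : 0 <= A u v * r v.
  by rewrite mulr_ge0 ?(eigen_A_ge0 E) ?(eigen_r_ge0 E).
have [->|Buv] := eqVneq (B u v) 0; first by rewrite mul0r mulr_ge0 ?exprn_ge0.
have uv : (u < v)%N by have := eigen_band E' Buv; lia.
have [vN|Nv] := leqP v N; last first.
  by rewrite r'_supp// mulr0 mulr_ge0 ?exprn_ge0.
have r'v : r' v <= m ^+ (N - u) * r v.
  rewrite (le_trans (IH v _ vN))//; first by lia.
  rewrite mulrA ler_wpM2r ?(eigen_r_ge0 E)//.
  rewrite (_ : (N - u = (N - v).+1 + (v - u.+1))%N); last by lia.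
  rewrite exprD exprS (le_trans _ (ler_peMr _ (exprn_ege1 _ m1)))//.
    by rewrite ler_wpM2r ?exprn_ge0.
  by rewrite mulr_ge0 ?exprn_ge0.
rewrite mulrCA; apply: ler_pM => //; first exact: eigen_A_ge0 E' _ _.
exact: eigen_r_ge0 E' _.
Qed.

(** For t < 1 the bound above at vertex 1 would read 1 <= t. *)
Lemma ratio_ge1 : 1 <= t.
Proof.
rewrite leNgt; apply/negP => t1.
have := right_upper_max (lexx 1) (ltW t1) N0.
by rewrite expr1n (eigen_r1 E) (eigen_r1 E') !mulr1 leNgt t1.
Qed.

Lemma right_upper u : (u <= N)%N -> r' u <= t ^+ (N - u).+1 * r u.
Proof.
by move=> uN; rewrite exprS -mulrA; exact: right_upper_max ratio_ge1 _ uN.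
Qed.

Lemma left_upper v : (0 < v)%N -> l' v <= t ^+ v.-1 * l v.
Proof.
have [j] := ubnP v; elim: j v => // j IH v; rewrite ltnS => vj v0.
have [v1|v2] := leqP v 1.
  have -> : v = 1%N by lia.
  by rewrite expr0 mul1r (eigen_l1 E) (eigen_l1 E').
rewrite (eigen_left E)// (eigen_left E')// rhoE.
rewrite (mulrC t) -mulrA [leRHS]mulrCA ler_pM2l//.
rewrite !mulr_sumr big_nat [leRHS]big_nat; apply: ler_sum => u uv.
rewrite [leLHS]mulrA mulrA; apply: ler_pM; rewrite ?(eigen_A_ge0 E')//.
  by rewrite mulr_ge0 ?(eigen_l_ge0 E') ?ltW.
have IHu : l' u <= t ^+ u.-1 * l u by apply: IH; lia.
rewrite (le_trans (ler_wpM2l (ltW t0) IHu))//.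
rewrite mulrA -exprS ler_wpM2r ?(eigen_l_ge0 E)//.
by apply: ler_weXn2l; [exact: ratio_ge1|lia].
Qed.

Lemma mass_upper M :
  \sum_(1 <= u < M) l' u * r' u <= t ^+ N * \sum_(1 <= u < M) l u * r u.
Proof.
rewrite mulr_sumr big_nat [leRHS]big_nat; apply: ler_sum => u u1.
have [uN|Nu] := leqP u N; last first.
  rewrite r'_supp// mulr0 mulr_ge0 ?exprn_ge0 ?(ltW t0)//.
  by rewrite mulr_ge0 ?(eigen_l_ge0 E) ?(eigen_r_ge0 E).
have u0 : (0 < u)%N by lia.
rewrite (_ : (N = u.-1 + (N - u).+1)%N); last by lia.
rewrite exprD mulrACA; apply: ler_pM;
  rewrite ?(eigen_l_ge0 E') ?(eigen_r_ge0 E')//.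
  exact: left_upper.
exact: right_upper.
Qed.

End Upper.

Section Lower.
Variable n : nat.
Hypothesis t1 : 1 <= t.
(** The relation reach k u stands for a path of k forward steps from 1 to u;
    the subgraph keeps an edge if such a path to its source, completed by the
    edge and a return to 1, has length at most n. *)
Variable reach : nat -> nat -> Prop.
Hypothesis reach1 : reach 0 1%N.
Hypothesis reachS : forall k u v,
  reach k u -> A u v != 0 -> (2 <= v)%N -> reach k.+1 v.
Hypothesis succ_neq0 : forall u, (0 < u)%N -> A u u.+1 != 0.
Hypothesis B_forward : forall k u v, reach k u -> (2 <= v)%N ->
  (k.+2 <= n)%N -> B u v = A u v.
Hypothesis B_return : forall k u, reach k u -> (k.+1 <= n)%N ->
  B u 1%N = A u 1%N.

Lemma reach_pred u : (0 < u)%N -> reach u.-1 u.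
Proof.
case: u => // u _; elim: u => [//|u IH].
exact: reachS IH (succ_neq0 _) _.
Qed.

(** A simple cycle with at most n steps stays in the subgraph, where each of
    its steps, and it has at least one, is worth t times as much. *)
Lemma right_lower m k u : reach k u -> (k + m <= n)%N ->
  t * (r u - survival A K rho r m u) <= r' u.
Proof.
elim: m k u => [|m IH] k u ku kmn.
  by rewrite /survival /= subrr mulr0 (eigen_r_ge0 E').
rewrite (survivalS E) [in leRHS](eigen_right E') rhoE -mulrA ler_pM2l//.
rewrite ler_pM2l// (B_return ku) ?lerD2l; last by lia.
rewrite big_nat [leRHS]big_nat; apply: ler_sum => v v2.
have s0 x : 0 <= r x - survival A K rho r m x.
  by rewrite subr_ge0 (survival_le E).
case: m IH kmn s0 => [|m] IH kmn s0.
  rewrite /survival /= subrr mulr0.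
  by rewrite mulr_ge0 ?(eigen_A_ge0 E') ?(eigen_r_ge0 E').
rewrite (B_forward ku); [|lia|lia].
have [->|Auv] := eqVneq (A u v) 0; first by rewrite !mul0r.
rewrite ler_wpM2l ?(eigen_A_ge0 E)//.
have kv : reach k.+1 v by apply: reachS ku Auv _; lia.
by rewrite (le_trans _ (IH _ _ kv _)) ?ler_peMl//; lia.
Qed.

Lemma ratio_survival_le1 : t * (1 - survival A K rho r n 1%N) <= 1.
Proof.
rewrite -{1}(eigen_r1 E) -[leRHS](eigen_r1 E').
by apply: right_lower reach1 _; lia.
Qed.

(** Vertex u is reached in u - 1 steps, so no edge between two vertices up to n
    is missing from the subgraph. *)
Lemma left_lower v : (0 < v <= n)%N -> l v <= l' v.
Proof.
have [j] := ubnP v; elim: j v => // j IH v; rewrite ltnS => vj /andP[v0 vn].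
have [v1|v2] := leqP v 1.
  have -> : v = 1%N by lia.
  by rewrite (eigen_l1 E) (eigen_l1 E').
rewrite (eigen_left E)// (eigen_left E')// rhoE -mulrA.
have sum0 : 0 <= \sum_(1 <= u < v) l u * A u v.
  by apply: sumr_ge0 => u _; rewrite mulr_ge0 ?(eigen_l_ge0 E) ?(eigen_A_ge0 E).
rewrite (le_trans (ler_peMl _ t1)) ?mulr_ge0 ?(ltW rho0)//.
rewrite ler_pM2l// ler_pM2l// big_nat [leRHS]big_nat.
apply: ler_sum => u uv; have u0 : (0 < u)%N by lia.
rewrite (B_forward (reach_pred u0)); [|lia|lia].
by rewrite ler_wpM2r ?(eigen_A_ge0 E)// IH//; lia.
Qed.

End Lower.
End Subgraph.
End Comparison.
(** * Normalised eigenvectors of an equilibrium measure *)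

Lemma esum_cvg {R : realType} (V : set nat) (F : nat -> R) (S : R) :
  (forall u, 0 <= F u) -> (forall u, F u != 0 -> V u /\ (0 < u)%N) ->
  \esum_(u in V) (F u)%:E = S%:E ->
  (fun M => \sum_(1 <= u < M) F u) @ \oo --> S.
Proof.
move=> F0 FV; rewrite esum_mkcond.
rewrite (eq_esum (b := fun u => (F u)%:E)); last first.
  move=> u _; case: ifPn => // /negP uV; congr EFin.
  by apply/eqP; rewrite eq_sym; apply: contra_notT uV => /FV[? _]; rewrite inE.
rewrite -nneseries_esumT; last by move=> u; rewrite lee_fin.
move=> FS.
have : (fun n => (\sum_(0 <= u < n) (F u)%:E)%E) @ \oo --> S%:E.
  by rewrite -FS; apply: is_cvg_nneseries => u _ _; rewrite lee_fin.
under eq_fun do rewrite sumEFin.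
move/fine_cvgP => [_]; apply: cvg_trans; apply: near_eq_cvg.
near=> M; rewrite /= big_ltn; last by near: M; exists 1%N.
case: (F 0%N =P 0) => [->|/eqP/FV[]//]; first by rewrite add0r.
Unshelve. all: by end_near. Qed.

Lemma esum_finite_support {R : realType} (V : set nat) (F : nat -> R)
    (S : R) b :
  (forall u, 0 <= F u) -> (forall u, F u != 0 -> V u /\ (0 < u < b)%N) ->
  \esum_(u in V) (F u)%:E = S%:E ->
  S = \sum_(1 <= u < b) F u.
Proof.
move=> F0 FV FS.
have cS : (fun M => \sum_(1 <= u < M) F u) @ \oo --> S.
  by apply: (esum_cvg F0 _ FS) => u /FV[? /andP[]].
rewrite -(cvg_lim _ cS)//; apply: cvg_lim => //.
apply: cvg_near_cst; near=> M.
have bM : (b <= M)%N by near: M; exists b.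
apply/eqP; rewrite eq_le !ler_sum_nat_support//.
- by move=> u ub _; lia.
- by move=> u uM /FV[_]; lia.
Unshelve. all: by end_near. Qed.

Section Equilibrium.
Context {R : realType}.
Variables (H : digraph) (W : nat -> nat -> R) (K : nat).
Hypothesis K0 : (0 < K)%N.
Hypothesis H1 : verts H 1%N.
Hypothesis H_gt0 : forall u, verts H u -> (0 < u)%N.
Hypothesis H_band : forall u v, edges H (u, v) -> v = 1%N \/ (u < v < u + K)%N.
Hypothesis W_gt0 : forall e, edges H e -> 0 < W e.1 e.2.
Let A := adjacency H W.

Lemma adjacency_neq0 u v : A u v != 0 -> edges H (u, v).
Proof. by rewrite /A /adjacency; case: asboolP => //; rewrite eqxx. Qed.

Lemma adjacency_ge0 u v : 0 <= A u v.
Proof. by rewrite /A /adjacency; case: asboolP => // /W_gt0/ltW. Qed.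

(** The eigenvectors are only fixed up to scaling; dividing both by their
    values at vertex 1 moves the normalisation into the total mass Z. *)
Lemma equilibrium_eigenpair (mu : probability trajectories R) :
  is_equilibrium 1 H W mu ->
  exists (rho : R) (l r : nat -> R) (Z : R),
  [/\ eigenpair A K rho l r,
      forall u, verts H u -> 0 < l u,
      forall u, ~ verts H u -> r u = 0,
      0 < Z /\ (fun M => \sum_(1 <= u < M) l u * r u) @ \oo --> Z &
      forall s u p, (forall x, x \in u :: p -> verts H x) ->
        mu (cylinder s (u :: p)) =
        (rho ^+ size p * l u * path_weight A u p * r (last u p) / Z)%:E].
Proof.
move=> [_ [rho [l0 [r0 /= [[rho0 _] lr0 eigen lr1 cyl]]]]].
have [l10 r10] := lr0 _ H1.
have A0 := adjacency_ge0; have An := adjacency_neq0.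
have AV u v : A u v != 0 -> verts H u /\ verts H v.
  by move=> /An/edges_verts.
pose l u := if `[< verts H u >] then l0 u / l0 1%N else 0.
pose r u := if `[< verts H u >] then r0 u / r0 1%N else 0.
have lE u : verts H u -> l u = l0 u / l0 1%N by move=> Hu; rewrite /l asboolT.
have rE u : verts H u -> r u = r0 u / r0 1%N by move=> Hu; rewrite /r asboolT.
have l_ge0 u : 0 <= l u.
  by rewrite /l; case: asboolP => // /lr0[/ltW ? _]; rewrite divr_ge0// ltW.
have r_ge0 u : 0 <= r u.
  by rewrite /r; case: asboolP => // /lr0[_ /ltW ?]; rewrite divr_ge0// ltW.
have lAE u v : l u * A u v = l0 u * A u v / l0 1%N.
  have [->|/AV[Hu _]] := eqVneq (A u v) 0; first by rewrite !mulr0 mul0r.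
  by rewrite lE// mulrAC.
have rAE u v : A u v * r v = A u v * r0 v / r0 1%N.
  have [->|/AV[_ Hv]] := eqVneq (A u v) 0; first by rewrite !mul0r.
  by rewrite rE// mulrA.
have lA0 u v : 0 <= l0 u * A u v.
  have [->|/AV[/lr0[/ltW ? _] _]] := eqVneq (A u v) 0; first by rewrite mulr0.
  exact: mulr_ge0.
have rA0 u v : 0 <= A u v * r0 v.
  have [->|/AV[_ /lr0[_ /ltW ?]]] := eqVneq (A u v) 0; first by rewrite mul0r.
  exact: mulr_ge0.
exists rho, l, r, ((l0 1%N * r0 1%N)^-1); split.
- split => //.
  + by move=> u v /An/H_band.
  + by rewrite lE// divff// gt_eqF.
  + by rewrite rE// divff// gt_eqF.
  + move=> v v2; under eq_bigr do rewrite lAE.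
    rewrite -mulr_suml; have [Hv|nHv] := pselect (verts H v).
      have [lA _] := eigen _ Hv.
      rewrite -(esum_finite_support (lA0 ^~ v) _ lA).
        by rewrite lE// !mulrA divff ?mul1r ?gt_eqF.
      move=> u; rewrite mulf_eq0 negb_or.
      move=> /andP[_ /[dup] /AV[Hu _] /An/H_band].
      by have := H_gt0 Hu; split => //; lia.
    rewrite /l asboolF// big1 ?mul0r ?mulr0// => u _.
    by have [->|/AV[]//] := eqVneq (A u v) 0; rewrite mulr0.
  + move=> u; have [Hu|nHu] := pselect (verts H u); last first.
      rewrite /r asboolF// [A u 1%N](_ : _ = 0); last first.
        by have [|/AV[]] := eqVneq (A u 1%N) 0.
      rewrite add0r big1 ?mulr0// => v _.
      by have [->|/AV[]//] := eqVneq (A u v) 0; rewrite mul0r.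
    have [_ rA] := eigen _ Hu.
    rewrite rE// (_ : A u 1%N = A u 1%N * r0 1%N / r0 1%N); last first.
      by rewrite mulfK// gt_eqF.
    under eq_bigr do rewrite rAE.
    rewrite -mulr_suml -mulrDl mulrA; congr (_ / _).
    have uK : (1 < u + K)%N by have := H_gt0 Hu; lia.
    rewrite (_ : _ + _ = \sum_(1 <= v < u + K) A u v * r0 v); last first.
      by rewrite [RHS]big_ltn.
    rewrite -(esum_finite_support (rA0 u) _ rA).
      by rewrite mulrA divff ?mul1r ?gt_eqF.
    move=> v; rewrite mulf_eq0 negb_or.
    move=> /andP[/[dup] /AV[_ Hv] /An/H_band + _].
    by have := H_gt0 Hv; split => //; lia.
- by move=> u Hu; rewrite lE// divr_gt0//; case: (lr0 _ Hu).
- by move=> u nHu; rewrite /r asboolF.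
- split; first by rewrite invr_gt0 mulr_gt0.
  pose F u := if `[< verts H u >] then l0 u * r0 u else 0.
  have cF : (fun M => \sum_(1 <= u < M) F u) @ \oo --> (1 : R).
    apply: (esum_cvg (V := verts H)) => [u|u|].
    + rewrite /F; case: asboolP => // /lr0[/ltW ? /ltW ?]; exact: mulr_ge0.
    + rewrite /F; case: asboolP => [Hu _|]; last by rewrite eqxx.
      by split => //; exact: H_gt0.
    + rewrite -[RHS]lr1; apply: eq_esum => u Hu.
      by rewrite /F asboolT.
  rewrite -[X in _ --> X]mul1r; under eq_fun => M.
    under eq_bigr => u _.
      rewrite (_ : l u * r u = F u / (l0 1%N * r0 1%N)); last first.
        rewrite /l /r /F; case: asboolP => _; last by rewrite !mul0r.
        by rewrite invfM mulrACA.
      over.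
    rewrite -mulr_suml; over.
  exact: cvgMl.
- move=> s u p up.
  rewrite cyl// lE ?rE; [|by apply: up; rewrite ?mem_last ?mem_head..].
  rewrite -exprVn invrK; congr EFin; field.
  by rewrite !gt_eqF.
Qed.

End Equilibrium.
(** * The subgraphs spanned by short simple cycles *)

Section Paths.
Implicit Types (G H : digraph) (u v w : nat) (p q : seq nat).

Lemma steps_cons u v p : steps u (v :: p) = (u, v) :: steps v p.
Proof. by []. Qed.

Lemma steps_cat u p q : steps u (p ++ q) = steps u p ++ steps (last u p) q.
Proof. by elim: p u => //= v p IH u; rewrite !steps_cons IH. Qed.

Lemma is_path_cat H u v w p q :
  is_path H u v p -> is_path H v w q -> is_path H u w (p ++ q).
Proof.
move=> [p0 pH pv] [q0 qH qw]; split.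
- by rewrite size_cat addn_gt0 p0.
- by move=> e; rewrite steps_cat pv mem_cat => /orP[/pH|/qH].
- by rewrite last_cat pv.
Qed.

End Paths.

Section LinearGraph.
Variable G : digraph.
Hypothesis G_verts : verts G = [set i | (0 < i)%N].
Hypothesis G_return : forall i, (0 < i)%N -> edges G (i, 1%N).
Hypothesis G_succ : forall i, (0 < i)%N -> edges G (i, i.+1).

Lemma edge_gt0 i j : edges G (i, j) -> (0 < i)%N /\ (0 < j)%N.
Proof. by move=> /edges_verts; rewrite G_verts. Qed.

(** A simple 1-cycle is such a path followed by the edge back to 1. *)
Definition rise_path p :=
  (forall e, e \in steps 1 p -> edges G e) /\ 1%N \notin p.

Definition rise k u :=
  exists p, [/\ rise_path p, size p = k & last 1%N p = u].

Lemma rise0 : rise 0 1.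
Proof. by exists [::]. Qed.

Lemma riseS k u v : rise k u -> edges G (u, v) -> (2 <= v)%N -> rise k.+1 v.
Proof.
move=> [p [[pG p1] pk pu]] Guv v2; exists (rcons p v); split.
- split; last by rewrite mem_rcons inE negb_or p1 andbT; lia.
  move=> e; rewrite -cats1 steps_cat mem_cat pu => /orP[/pG//|].
  by rewrite inE => /eqP->.
- by rewrite size_rcons pk.
- by rewrite last_rcons.
Qed.

Lemma rise_pred u : (0 < u)%N -> rise u.-1 u.
Proof.
case: u => // u _; elim: u => [|u IH]; first exact: rise0.
by apply: riseS IH (G_succ _) _.
Qed.

Lemma Gsub_sub n : subgraph (Gsub 1 G n) G.
Proof.
have sub_edges : edges (Gsub 1 G n) `<=` edges G.
  by move=> e [g [-> [[_ gG _] _] _]] /gG.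
split => // u [[_ p] /= [-> [[_ pG _] _] _]].
rewrite inE G_verts => /predU1P[->//|].
suff gt0 x : (forall e, e \in steps x p -> edges G e) -> u \in p -> (0 < u)%N.
  exact: gt0 pG.
elim: p x {pG} => // v p IH x pG; rewrite inE => /predU1P[->|].
  by case: (edge_gt0 (pG (x, v) (mem_head _ _))).
by apply: (IH v) => e ep; apply: pG; rewrite steps_cons inE ep orbT.
Qed.

Lemma rise_path_last_gt0 p : rise_path p -> (0 < last 1 p)%N.
Proof.
case/lastP: p => [//|p x] [pG _]; rewrite last_rcons.
case: (@edge_gt0 (last 1%N p) x) => //; apply: pG.
by rewrite -cats1 steps_cat mem_cat mem_seq1 eqxx orbT.
Qed.

Lemma rise_path_Gsub p n : rise_path p -> (size p < n)%N ->
  forall e, e \in steps 1 (rcons p 1) -> edges (Gsub 1 G n) e.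
Proof.
move=> rp pn e ep; have [pG p1] := rp.
exists (1%N, rcons p 1%N) => //; split => //=; last by rewrite size_rcons.
split; last by rewrite -cats1 count_cat/= (count_memPn p1).
split; [by rewrite size_rcons| |by rewrite last_rcons].
move=> f; rewrite -cats1 steps_cat mem_cat => /orP[/pG//|].
by rewrite mem_seq1 => /eqP->; exact/G_return/rise_path_last_gt0.
Qed.

Lemma Gsub_return k u n : rise k u -> (k.+1 <= n)%N ->
  edges (Gsub 1 G n) (u, 1%N).
Proof.
move=> [p [rp <- <-]] pn; apply: rise_path_Gsub rp pn _ _.
by rewrite -cats1 steps_cat mem_cat mem_seq1 eqxx orbT.
Qed.

Lemma Gsub_forward k u v n : rise k u -> edges G (u, v) -> (2 <= v)%N ->
  (k.+2 <= n)%N -> edges (Gsub 1 G n) (u, v).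
Proof.
move=> [p [[pG p1] pk pu]] Guv v2 kn.
apply: (@rise_path_Gsub (rcons p v)); last 1 first.
- rewrite -!cats1 !steps_cat !mem_cat pu mem_seq1 eqxx orbT.
  by [].
- split; last by rewrite mem_rcons inE negb_or p1 andbT; lia.
  move=> e; rewrite -cats1 steps_cat mem_cat pu => /orP[/pG//|].
  by rewrite inE => /eqP->.
- by rewrite size_rcons pk.
Qed.

Lemma Gsub_vert1 n : (0 < n)%N -> verts (Gsub 1 G n) 1%N.
Proof. by move=> /(Gsub_return rise0) /edges_verts[]. Qed.

Lemma Gsub_vert n u : (0 < u <= n)%N -> verts (Gsub 1 G n) u.
Proof.
move=> /andP[u0 un]; have /edges_verts[] // : edges (Gsub 1 G n) (u, 1%N).
by apply: Gsub_return (rise_pred u0) _; lia.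
Qed.

Lemma Gsub_edge n u v : edges G (u, v) -> (u < n)%N ->
  edges (Gsub 1 G n) (u, v).
Proof.
move=> Guv un; have [u0 v0] := edge_gt0 Guv.
have [v1|v2] := leqP v 1.
  have -> : v = 1%N by lia.
  by apply: Gsub_return (rise_pred u0) _; lia.
by apply: Gsub_forward (rise_pred u0) Guv v2 _; lia.
Qed.

(** Every vertex lies on a 1-cycle inside the subgraph, whose two arcs join
    it to vertex 1 in both directions. *)
Lemma Gsub_connected n : connected_graph (Gsub 1 G n).
Proof.
suff join u : verts (Gsub 1 G n) u ->
    (exists p, is_path (Gsub 1 G n) u 1 p) /\
    (exists p, is_path (Gsub 1 G n) 1 u p).
  move=> u w /join[[p up] _] /join[_ [q qw]].
  by exists (p ++ q); exact: is_path_cat up qw.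
move=> [[_ p] /= [-> [[p0 pG pl] p1] pn]] up.
have pGn e : e \in steps 1 p -> edges (Gsub 1 G n) e.
  by move=> ep; exists (1%N, p).
have [u1|u1] := eqVneq u 1%N; first by rewrite u1; split; exists p.
move: up; rewrite inE (negbTE u1) /= => /splitPr up.
case: p / up {p0 pG p1 pn} pl pGn => q1 q2; rewrite last_cat /= => ql.
rewrite (_ : q1 ++ u :: q2 = (q1 ++ [:: u]) ++ q2) => [qG|]; last first.
  by rewrite -catA.
split; [exists q2|exists (q1 ++ [:: u])]; split => //.
- by case: q2 ql {qG} => //= u1'; rewrite u1' eqxx in u1.
- by move=> e eq2; apply: qG; rewrite steps_cat mem_cat last_cat /= eq2 orbT.
- by rewrite size_cat addn1.
- by move=> e eq1; apply: qG; rewrite steps_cat mem_cat eq1.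
- by rewrite last_cat.
Qed.

Lemma Gsub_exhaustive : exhaustive G (fun k => Gsub 1 G k.+1).
Proof.
split.
- move=> k; have cycles g : [/\ g.1 = 1%N, simple_cycle G 1 g.2 &
      (size g.2 <= k.+1)%N] -> [/\ g.1 = 1%N, simple_cycle G 1 g.2 &
      (size g.2 <= k.+2)%N] by move=> [? ? /leqW].
  by split => [u|e] [g /cycles]; exists g.
- apply/seteqP; split => [u [k _]|u].
    by case: (Gsub_sub k.+1) => + _; apply.
  by rewrite G_verts => /= u0; exists u => //; apply: Gsub_vert; lia.
- apply/seteqP; split => [e [k _]|[u v] Guv].
    by case: (Gsub_sub k.+1) => _; apply.
  by exists u => //; apply: Gsub_edge.
Qed.

Section BoundedJumps.
Variable K : nat.
Hypothesis G_band : forall i j, edges G (i, j) -> j = 1%N \/ (i < j < i + K)%N.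

Lemma path_bound u p :
  (0 < u)%N -> (forall e, e \in steps u p -> edges G e) ->
  forall x, x \in u :: p -> (x <= u + size p * K)%N.
Proof.
elim: p u => [|v p IH] u u0 pG x; first by rewrite inE => /eqP->; lia.
rewrite inE => /predU1P[->|xp]; first by lia.
have Guv := pG (u, v) (mem_head _ _).
have v0 : (0 < v)%N by case: (edge_gt0 Guv).
have vu : (v <= u + K)%N by have := G_band Guv; lia.
have := IH v v0 _ x xp; rewrite /= mulSn => IHx.
have : (x <= v + size p * K)%N.
  by apply: IHx => e ep; apply: pG; rewrite steps_cons inE ep orbT.
lia.
Qed.

Lemma Gsub_bound n u : verts (Gsub 1 G n) u -> (0 < u <= (n * K).+1)%N.
Proof.
move=> Hu; apply/andP; split.
  by have [/(_ u Hu)] := Gsub_sub n; rewrite G_verts.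
have [[_ p] /= [-> [[_ pG _] _] pn]] := Hu.
move=> /(@path_bound 1%N p isT pG) /leq_trans; apply.
by rewrite add1n ltnS leq_mul2r pn orbT.
Qed.

Lemma Gsub_finite n : finite_set (verts (Gsub 1 G n)).
Proof.
apply: (sub_finite_set _ (finite_II (n * K).+2)) => u /Gsub_bound/andP[_].
by rewrite /= ltnS.
Qed.

End BoundedJumps.
End LinearGraph.
(** * Regularity *)

Section MassSeries.
Context {R : realType}.
Variables (f : nat -> R) (Z : R).
Hypothesis f0 : forall u, 0 <= f u.
Hypothesis fZ : (fun M => \sum_(1 <= u < M) f u) @ \oo --> Z.

Lemma partial_sum_le M : \sum_(1 <= u < M) f u <= Z.
Proof.
rewrite -(cvg_lim _ fZ)//.
apply: (@nondecreasing_cvgn_le _ (fun M => \sum_(1 <= u < M) f u)); last first.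
  by apply/cvg_ex; exists Z.
by move=> a b ab; apply: ler_sum_nat_support => // u ua _; lia.
Qed.

Lemma tail_sum_small e : 0 < e ->
  exists a, forall M, \sum_(a <= u < M) f u <= e.
Proof.
move=> e0; have /cvgrPdist_le/(_ e e0) [a _ aP] := fZ.
exists a.+1 => M; have [Ma|aM] := leqP M a.+1; first by rewrite big_geq// ltW.
have := aP a.+1 (leqnSn a); have := partial_sum_le M.
rewrite (big_cat_nat (n := a.+1))//=; last exact: ltnW.
by rewrite ler_norml => ? /andP[]; lra.
Qed.

End MassSeries.

Section Regularity.
Context {R : realType}.
Variables (G : digraph) (W : nat -> nat -> R) (K : nat).
Hypothesis K0 : (0 < K)%N.
Hypothesis G_verts : verts G = [set i | (0 < i)%N].
Hypothesis G_return : forall i, (0 < i)%N -> edges G (i, 1%N).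
Hypothesis G_succ : forall i, (0 < i)%N -> edges G (i, i.+1).
Hypothesis G_band : forall i j, edges G (i, j) -> j = 1%N \/ (i < j < i + K)%N.
Hypothesis W_gt0 : forall e, edges G e -> 0 < W e.1 e.2.
Let A := adjacency G W.
Let B n := adjacency (Gsub 1 G n) W.

Lemma adjacency_Gsub_le n u v : B n u v <= A u v.
Proof.
rewrite /A /B /adjacency; case: asboolP => [|_].
  by case: (Gsub_sub G_verts n) => _ /[apply] Guv; rewrite asboolT.
by case: asboolP => // /W_gt0/ltW.
Qed.

Lemma adjacency_Gsub n u v : edges (Gsub 1 G n) (u, v) \/ ~ edges G (u, v) ->
  B n u v = A u v.
Proof.
have [_ sub] := Gsub_sub G_verts n.
rewrite /A /B /adjacency => -[Guv|nGuv].
  by rewrite !asboolT//; exact: sub.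
by rewrite !asboolF// => /sub.
Qed.

Section Bound.
Variables (rho : R) (l r : nat -> R) (Z : R) (n : nat).
Variables (rho' : R) (l' r' : nat -> R) (Z' : R).
Hypothesis E : eigenpair A K rho l r.
Hypothesis E' : eigenpair (B n) K rho' l' r'.
Hypothesis r'_supp : forall u, ~ verts (Gsub 1 G n) u -> r' u = 0.
Hypothesis Z0 : 0 < Z.
Hypothesis Z'0 : 0 < Z'.
Hypothesis lrZ : (fun M => \sum_(1 <= u < M) l u * r u) @ \oo --> Z.
Hypothesis lrZ' : (fun M => \sum_(1 <= u < M) l' u * r' u) @ \oo --> Z'.
Let t := rho' / rho.
Let N := (n * K).+1.
Local Notation surv := (survival A K rho r).

Let r'_gtN u : (N < u)%N -> r' u = 0.
Proof.
move=> Nu; apply: r'_supp => /(Gsub_bound G_verts G_band).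
by rewrite /N in Nu *; lia.
Qed.

Let t1 : 1 <= t.
Proof.
exact: (ratio_ge1 E E' (adjacency_Gsub_le n) (isT : (0 < N)%N) r'_gtN).
Qed.

Let lr_ge0 u : 0 <= l u * r u.
Proof. by rewrite mulr_ge0 ?(eigen_l_ge0 E) ?(eigen_r_ge0 E). Qed.

Let forward k u v : rise G k u -> (2 <= v)%N -> (k.+2 <= n)%N ->
  B n u v = A u v.
Proof.
move=> ku v2 kn; apply: adjacency_Gsub.
have [Guv|] := pselect (edges G (u, v)); last by right.
by left; exact: (Gsub_forward G_verts G_return ku).
Qed.

Let return_ k u : rise G k u -> (k.+1 <= n)%N -> B n u 1%N = A u 1%N.
Proof.
move=> ku kn; apply: adjacency_Gsub; left.
exact: (Gsub_return G_verts G_return ku).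
Qed.

Let step k u v : rise G k u -> A u v != 0 -> (2 <= v)%N -> rise G k.+1 v.
Proof. by move=> ku /adjacency_neq0; exact: riseS. Qed.

Lemma total_mass_upper : Z' <= t ^+ N * Z.
Proof.
apply: (cvgr_to_le lrZ'); apply: nearW => M.
have N0 : (0 < N)%N by [].
apply: (le_trans (mass_upper E E' (adjacency_Gsub_le n) N0 r'_gtN M)).
rewrite ler_wpM2l ?exprn_ge0//; first exact: le_trans t1.
exact: (partial_sum_le lr_ge0 lrZ).
Qed.

(** Bernoulli's inequality turns the estimate of the ratio t into one of the
    power of t that governs the total mass. *)
Lemma ratio_power_survival_le1 : t ^+ N * (1 - N%:R * surv n 1%N) <= 1.
Proof.
have s0 : 0 <= surv n 1%N := survival_ge0 E _ _.
have s1 : surv n 1%N <= 1.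
  by rewrite -[leRHS](eigen_r1 E); exact: (survival_le E).
have bernoulli j : 1 - j%:R * surv n 1%N <= (1 - surv n 1%N) ^+ j.
  elim: j => [|j IH]; first by rewrite mul0r subr0 expr0.
  rewrite exprS (le_trans _ (ler_wpM2l _ IH)) ?subr_ge0//.
  by rewrite -natr1; have : 0 <= j%:R :> R by []; nra.
have t0 : 0 <= t by exact: le_trans t1.
apply: (le_trans (ler_wpM2l (exprn_ge0 _ t0) (bernoulli N))).
rewrite -exprMn; apply: exprn_ile1; first by rewrite mulr_ge0 ?subr_ge0.
exact: (ratio_survival_le1 E E' t1 (rise0 G) step forward return_).
Qed.

Lemma cylinder_weight_lower (m u v : nat) (c : R) :
  0 <= c -> (0 < u <= n)%N -> (0 < v <= n)%N ->
  rho ^+ m * l u * c * (r v - surv (n - v) v) * (1 - N%:R * surv n 1%N) / Z <=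
  rho' ^+ m * l' u * c * r' v / Z'.
Proof.
move=> c0 un vn.
have rho0 := eigen_rho_gt0 E; have rho0' := eigen_rho_gt0 E'.
have rho_le : rho <= rho'.
  by move: t1; rewrite /t ler_pdivlMr// mul1r.
have succ u' : (0 < u')%N -> A u' u'.+1 != 0.
  move=> /G_succ Gu; rewrite /A /adjacency asboolT// gt_eqF//.
  exact: (W_gt0 Gu).
have l_le : l u <= l' u.
  exact: (left_lower E E' t1 (rise0 G) step succ forward).
have y0 : 0 <= r v - surv (n - v) v by rewrite subr_ge0 (survival_le E).
have r_le : r v - surv (n - v) v <= r' v.
  have v0 : (0 < v)%N by lia.
  apply: (le_trans (ler_peMl y0 t1)).
  have rise_v := rise_pred G_succ v0.
  by apply: (right_lower E E' t1 step forward return_ rise_v); lia.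
have a0 : 0 <= rho ^+ m * l u * c * (r v - surv (n - v) v).
  by rewrite !mulr_ge0 ?exprn_ge0 ?(eigen_l_ge0 E) ?(ltW rho0).
have b0 : 0 <= rho' ^+ m * l' u * c * r' v.
  rewrite !mulr_ge0 ?exprn_ge0 ?(ltW rho0')//; first exact: (eigen_l_ge0 E').
  exact: (eigen_r_ge0 E').
have ab : rho ^+ m * l u * c * (r v - surv (n - v) v) <=
    rho' ^+ m * l' u * c * r' v.
  apply: ler_pM => //.
    by rewrite !mulr_ge0 ?exprn_ge0 ?(eigen_l_ge0 E) ?(ltW rho0).
  rewrite ler_wpM2r//; apply: ler_pM => //; rewrite ?exprn_ge0 ?(ltW rho0)//.
    exact: eigen_l_ge0 E _.
  by apply: lerXn2r; rewrite ?nnegrE ?(ltW rho0) ?(ltW rho0').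
set x := 1 - N%:R * surv n 1%N.
have [x0|x0] := leP x 0.
  apply: (@le_trans _ _ 0); last by rewrite divr_ge0// ltW.
  by rewrite -mulrA mulr_ge0_le0// mulr_le0_ge0// invr_ge0 ltW.
rewrite -mulrA; apply: ler_pM => //; first by rewrite divr_ge0 ?ltW.
rewrite ler_pdivrMr// mulrC ler_pdivlMr//.
apply: (le_trans (ler_wpM2l (ltW x0) total_mass_upper)).
rewrite mulrA ler_piMl ?(ltW Z0)// mulrC.
exact: ratio_power_survival_le1.
Qed.

End Bound.
Lemma mem_steps u p e : e \in steps u p -> e.1 \in u :: p.
Proof.
elim: p u => //= v p IH u; rewrite steps_cons inE => /predU1P[->|/IH ep].
  exact: mem_head.
by rewrite inE ep orbT.
Qed.

Lemma path_weight_Gsub n u p : (forall x, x \in u :: p -> (x < n)%N) ->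
  path_weight (B n) u p = path_weight A u p.
Proof.
move=> pn; apply: eq_big_seq => -[x y] /mem_steps /pn /= xn.
apply: adjacency_Gsub; have [Gxy|] := pselect (edges G (x, y)); last by right.
by left; exact: Gsub_edge.
Qed.

Lemma Omega_word (w : int -> nat) s u p : Omega G w -> cylinder s (u :: p) w ->
  forall x, x \in u :: p -> (0 < x)%N.
Proof.
move=> Gw Cw x /(nthP 0%N)[i ip <-]; rewrite -Cw//.
by have := edges_verts (Gw (s + i%:Z)); rewrite G_verts => -[].
Qed.

(** The lower bound for the finite measures tends to the limit measure, since
    n times the survival probability at n tends to 0. *)
Lemma lower_limit_cylinder (mu_ : nat -> probability trajectories R)
    (mu : probability trajectories R) (w : int -> nat) s u p :
  (forall k, is_equilibrium 1 (Gsub 1 G k.+1) W (mu_ k)) ->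
  is_equilibrium 1 G W mu -> Omega G w -> cylinder s (u :: p) w ->
  lower_limit_ge (mu (cylinder s (u :: p)))
    (fun k => mu_ k (cylinder s (u :: p))).
Proof.
move=> eq_ eq Gw Cw.
have word_gt0 := Omega_word Gw Cw.
have G1 : verts G 1%N by rewrite G_verts.
have G_gt0 x : verts G x -> (0 < x)%N by rewrite G_verts.
have [rho [l [r [Z [E l_gt0 _ [Z0 lrZ] muE]]]]] :=
  equilibrium_eigenpair K0 G1 G_gt0 G_band W_gt0 eq.
rewrite -/A in E muE.
have lr_ge0 x : 0 <= l x * r x.
  by rewrite mulr_ge0 ?(eigen_l_ge0 E) ?(eigen_r_ge0 E).
have lpos x : (0 < x)%N -> 0 < l x by move=> x0; apply: l_gt0; rewrite G_verts.
have tail := tail_sum_small lr_ge0 lrZ.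
set v := last u p; set c := path_weight A u p; set m := size p.
have u0 : (0 < u)%N := word_gt0 _ (mem_head _ _).
have v0 : (0 < v)%N := word_gt0 _ (mem_last _ _).
have c0 : 0 <= c.
  by apply: prodr_ge0 => e _; exact: (adjacency_ge0 W_gt0).
pose surv := survival A K rho r.
pose a k := rho ^+ m * l u * c * (r v - surv (k.+1 - v)%N v) *
  (1 - ((k.+1 * K).+1)%:R * surv k.+1 1%N) / Z.
have a_cvg : a @ \oo --> rho ^+ m * l u * c * r v / Z.
  have shift j : (fun k => (k.+1 - j)%N) @ \oo --> \oo.
    by apply/cvgnyPge => b; exists (b + j)%N => // k /= bk; lia.
  have sv : (fun k => surv (k.+1 - v)%N v) @ \oo --> (0 : R).
    exact: (cvg_comp _ _ (shift v) (survival_cvg0 E lpos tail v0)).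
  have succ_cvg : (fun k => k.+1) @ \oo --> \oo.
    by apply/cvgnyPge => b; exists b => // k /= bk; lia.
  have s1 : (fun k => surv k.+1 1%N) @ \oo --> (0 : R).
    have one_gt0 : (0 < 1)%N by [].
    exact: (cvg_comp _ _ succ_cvg (survival_cvg0 E lpos tail one_gt0)).
  have ns1 : (fun k => k.+1%:R * surv k.+1 1%N) @ \oo --> (0 : R).
    exact: (cvg_comp _ _ succ_cvg (survival1_small E tail)).
  rewrite [X in _ --> X](_ : _ =
    rho ^+ m * l u * c * (r v - 0) * (1 - (K%:R * 0 + 0)) / Z); last by ring.
  apply: cvgMl; apply: cvgM.
    by apply: cvgMr; apply: cvgB => //; exact: cvg_cst.
  apply: cvgB; first exact: cvg_cst.
  have -> : (fun k => (k.+1 * K).+1%:R * surv k.+1 1%N) =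
      (fun k => K%:R * (k.+1%:R * surv k.+1 1%N) + surv k.+1 1%N).
    by apply/funext => k; rewrite -natr1 natrM; ring.
  by apply: cvgD => //; exact: cvgMr.
move=> e e0; rewrite muE; last by move=> x /word_gt0; rewrite G_verts.
pose M := (\max_(x <- u :: p) x).+1.
have wordM x : x \in u :: p -> (x < M)%N.
  by move=> xp; rewrite ltnS /M; exact: leq_bigmax_seq.
have /cvgrPdist_le/(_ e e0) a_near := a_cvg.
near=> k.
have Mk : (M <= k.+1)%N by near: k; exists M => // k /=; lia.
have wordk x : x \in u :: p -> (0 < x <= k.+1)%N.
  by move=> xp; have := wordM _ xp; have := word_gt0 _ xp; lia.
have Gk1 : verts (Gsub 1 G k.+1) 1%N by exact: Gsub_vert1.
have Gk_gt0 x : verts (Gsub 1 G k.+1) x -> (0 < x)%N.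
  by move=> /(Gsub_bound G_verts G_band)/andP[].
have [_ Gk_sub] := Gsub_sub G_verts k.+1.
have [rho' [l' [r' [Z' [E' _ r'0 [Z'0 lrZ'] mukE]]]]] :=
  equilibrium_eigenpair K0 Gk1 Gk_gt0 (fun i j ij => G_band (Gk_sub _ ij))
    (fun e ee => W_gt0 (Gk_sub _ ee)) (eq_ k).
rewrite mukE; last by move=> x /wordk; exact: Gsub_vert.
rewrite -EFinD lee_fin -/v -/m -/(B k.+1) path_weight_Gsub -/c; last first.
  by move=> x /wordM; lia.
have un := wordk _ (mem_head _ _); have vn := wordk _ (mem_last _ _).
have lower := cylinder_weight_lower E E' r'0 Z0 Z'0 lrZ lrZ' m c0 un vn.
apply: (@le_trans _ _ (a k + e)); last by rewrite lerD2r.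
have : `|rho ^+ m * l u * c * r v / Z - a k| <= e by near: k.
by rewrite ler_norml => /andP[_]; lra.
Unshelve. all: by end_near. Qed.

End Regularity.

Theorem theorem5p3 (R : realType) (G : digraph) (W : nat -> nat -> R) :
  linear_graph G ->
  bounded_jumps G ->
  loaded_graph G W ->
  unstable_positive G W ->
  regular 1 G W (fun k : nat => Gsub 1 G k.+1).
Proof.
move=> [G_verts [E2 [E2P _ G_edges]]] [K K0 jumps] [W_gt0 _] _.
have G_return i : (0 < i)%N -> edges G (i, 1%N).
  by move=> i0; rewrite G_edges; left; split => //; left.
have G_succ i : (0 < i)%N -> edges G (i, i.+1).
  by move=> i0; rewrite G_edges; left; split => //; right.
have G_band i j : edges G (i, j) -> j = 1%N \/ (i < j < i + K)%N.
  move=> Gij; have [ij|ji] := ltnP i j.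
    by right; have := jumps i j Gij ij; lia.
  move: Gij; rewrite G_edges => -[[_ /= [->|ji']]|/E2P[_ ij]]; first by left.
  - by lia.
  - by lia.
split.
- exact: Gsub_exhaustive.
- by move=> k; split;
    [exact: (Gsub_finite G_verts G_band)|exact: Gsub_connected].
move=> mu_ mu eq_ eq.
have eq_k k : is_equilibrium 1 (Gsub 1 G k.+1) W (mu_ k).
  by apply: eq_; exact: Gsub_vert1.
have Omega_k k : mu_ k (Omega G) = 1%E.
  have [muk _] := eq_k k; have mG := @measurable_Omega.
  apply/eqP; rewrite eq_le probability_le1 ?mG//=.
  apply: (@le_trans _ _ (mu_ k (Omega (Gsub 1 G k.+1)))); first by rewrite muk.
  apply: le_measure; rewrite ?inE; try exact: mG.
  by move=> w Gw i; have [_] := Gsub_sub G_verts k.+1; apply; exact: Gw.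
apply: weak_cvg_cylinder => //; first by case: eq.
move=> s u p w.
exact: (lower_limit_cylinder K0 G_verts G_return G_succ G_band W_gt0 eq_k eq).
Qed.
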